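(* Let $p\ge 1$ and consider a D$p$-brane in static gauge, described by the Dirac-Born-Infeld action without worldvolume gauge fields, in a background with $G_{0i}=0$. Suppose the transverse scalars $Y^a$ of a static solution depend only on a single spatial worldvolume coordinate $x$. The regularized energy is $$E=T_p\int d^px\; e^{-\epsilon\phi}\left\{\sqrt{(-\det G)\left[1+G^{xx}G_{ab}\,\partial_xY^a\,\partial_xY^b\right]}-\sqrt{-\det G}\right\}.$$ Let $E(\lambda)$ be the energy of the configuration obtained by replacing $x\to\lambda x$ in the solution, leaving the other coordinates fixed. Stationarity of the energy under this deformation requires $$0=\left.\frac{dE}{d\lambda}\right|_{\lambda=1}=T_p\int d^px\;e^{-\epsilon\phi}\sqrt{\frac{-\det G}{1+G^{xx}G_{ab}\,\partial_xY^a\partial_xY^b}}\left\{\sqrt{1+G^{xx}G_{ab}\,\partial_xY^a\partial_xY^b}-1\right\}.$$ For nontrivial $\partial_xY^a$ the integrand is greater than zero, so this condition cannot be satisfied. Hence the Dirac-Born-Infeld action alone admits no solitons in which the transverse scalars depend on only one worldvolume coordinate. This holds for any brane dimension $p$, including $p=1$.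
   Context: A soliton is a finite-energy static solution of the equations of motion which is a minimum of the energy, so that its energy must be stationary under deformations such as rescalings of coordinates. $G_{\mu\nu}$ ($\mu=0,1,\dots,p$) is the background metric along the brane directions (Lorentzian, mostly plus), with $G_{0i}=0$ for spatial $i$; $G_{ab}$ is the (positive definite) metric in the transverse directions; $\phi$ is the dilaton. The background does not depend on the worldvolume coordinates but may depend on the transverse scalars $Y^a$. $\det G=\det(G_{\mu\nu})$ and $G^{xx}$ is the $xx$ component of the inverse of $G_{\mu\nu}$. $T_p>0$ is the tension; $\epsilon=1$ for a D-brane ($\epsilon=0$, $p=1$ for a string). In static gauge the worldvolume coordinates are identified with spacetime coordinates, and the induced metric is $g_{00}=G_{00}$, $g_{0i}=0$, $g_{ij}=G_{ij}+G_{ab}\partial_iY^a\partial_jY^b$; for scalars depending on $x$ only, $\det g=(1+G^{xx}G_{ab}\partial_xY^a\partial_xY^b)\det G$, and the Dirac-Born-Infeld energy density is $T_pe^{-\epsilon\phi}\sqrt{-\det g}$. The subtracted term in $E$ is chosen so that the trivial configuration $\partial_xY^a=0$ has zero energy. *)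

(* Defs.v *)
From HB Require Import structures.
From mathcomp Require Import all_boot all_order all_algebra.
From mathcomp Require Import all_classical all_reals all_analysis.
Set Implicit Arguments.
Unset Strict Implicit.
Unset Printing Implicit Defensive.
Import Order.TTheory GRing.Theory Num.Theory.
Import numFieldNormedType.Exports.
Local Open Scope classical_set_scope.
Local Open Scope ring_scope.

Definition partial (R : realType) (d : nat) (i : 'I_d) (f : 'rV[R]_d -> R)
  (x : 'rV[R]_d) : R := 'D_(delta_mx 0 i) f x.

Fixpoint class_C (R : realType) (d m : nat) (U : set 'rV[R]_d)
    (f : 'rV[R]_d -> R) {struct m} : Prop :=
  match m with
  | 0 => forall x, U x -> {for x, continuous f}
  | m'.+1 => (forall x, U x -> differentiable f x) /\
             (forall i, class_C m' U (partial i f))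
  end.

(* The integral of [f] over the box [\prod_i D i] of R^p with respect to
   d^px, as an iterated Lebesgue integral; by Tonelli this is the Lebesgue
   integral for the nonnegative measurable integrands considered here. *)
Fixpoint box_integral (R : realType) (p : nat) :
    ('I_p -> set R) -> ('rV[R]_p -> \bar R) -> \bar R :=
  match p with
  | 0 => fun _ f => f 0
  | q.+1 => fun D f =>
      (\int[lebesgue_measure]_(t in D ord0)
         box_integral (fun i => D (lift ord0 i))
           (fun v : 'rV[R]_q => f (row_mx (t%:M : 'rV[R]_1) v)))%E
  end.

(* Worldvolume indices mu = 0, 1, ..., p are elements of 'I_(1 + p). *)
Definition time {p : nat} : 'I_(1 + p) := lshift p ord0.
Definition space {p : nat} (i : 'I_p) : 'I_(1 + p) := rshift 1 i.

Definition minkowski (R : realType) (p : nat) : 'M[R]_(1 + p) :=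
  diag_mx (\row_mu (if mu == time then -1 else 1)).

Definition lorentzian (R : realType) (p : nat) (g : 'M[R]_(1 + p)) : Prop :=
  exists2 P : 'M[R]_(1 + p), P \in unitmx & g = P^T *m minkowski R p *m P.

Definition positive_definite (R : realType) (n : nat) (h : 'M[R]_n) : Prop :=
  h^T = h /\ forall v : 'rV[R]_n, v != 0 -> 0 < (v *m h *m v^T) 0 0.

(* The background fields depend on the n transverse scalars only.  They need
   be regular only on the region [bg_dom] of the transverse space, so that
   e.g. horizons may be excluded. *)
Record background (R : realType) (p n : nat) := Background {
  bg_dom : set 'rV[R]_n ;
  bg_G : 'rV[R]_n -> 'M[R]_(1 + p) ;
  bg_H : 'rV[R]_n -> 'M[R]_n ;        (* the transverse metric G_ab *)
  bg_phi : 'rV[R]_n -> R }.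

Definition static_background (R : realType) (p n : nat)
    (B : background R p n) : Prop :=
  [/\ open (bg_dom B),
      (forall mu nu, class_C 1 (bg_dom B) (fun y => bg_G B y mu nu)),
      (forall a b, class_C 1 (bg_dom B) (fun y => bg_H B y a b)),
      class_C 1 (bg_dom B) (bg_phi B) &
      forall y, bg_dom B y ->
        [/\ lorentzian (bg_G B y),
            bg_G B y time time < 0,
            (forall i, bg_G B y time (space i) = 0) &
            positive_definite (bg_H B y)]].

Section DiracBornInfeld.
Variables (R : realType) (p n : nat) (T eps : R) (B : background R p n).

(* The metric induced in static gauge on a brane through [y] whose scalars
   have gradient [v mu a] = d_mu Y^a. *)
Definition induced_metric (y : 'rV[R]_n) (v : 'M[R]_(1 + p, n)) :
    'M[R]_(1 + p) :=
  \matrix_(mu, nu) (bg_G B y mu nu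
     + \sum_a \sum_b bg_H B y a b * v mu a * v nu b).

Definition dbi_density (y : 'rV[R]_n) (v : 'M[R]_(1 + p, n)) : R :=
  expR (- (eps * bg_phi B y)) * Num.sqrt (- \det (induced_metric y v)).

Definition dbi_lagrangian (y : 'rV[R]_n) (v : 'M[R]_(1 + p, n)) : R :=
  - (T * dbi_density y v).

Definition gradient (X : 'rV[R]_(1 + p) -> 'rV[R]_n) (xi : 'rV[R]_(1 + p)) :
    'M[R]_(1 + p, n) :=
  \matrix_(mu, a) partial mu (fun zeta => X zeta 0 a) xi.

(* Euler-Lagrange equations of the action \int d^{p+1}xi dbi_lagrangian:
   d_mu (dL / d(d_mu Y^a)) = dL / dY^a. *)
Definition equations_of_motion (X : 'rV[R]_(1 + p) -> 'rV[R]_n) : Prop :=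
  forall (xi : 'rV[R]_(1 + p)) (a : 'I_n),
    \sum_mu partial mu (fun zeta =>
        'D_(delta_mx mu a) (dbi_lagrangian (X zeta)) (gradient X zeta)) xi
    = partial a (fun y => dbi_lagrangian y (gradient X xi)) (X xi).

(* A static configuration is given as a function of the p spatial
   coordinates; [static_field] is the corresponding field on spacetime. *)
Definition static_field (Y : 'rV[R]_p -> 'rV[R]_n) (xi : 'rV[R]_(1 + p)) :
  'rV[R]_n := Y (rsubmx xi).

Definition configuration (Y : 'rV[R]_p -> 'rV[R]_n) : Prop :=
  (forall a, class_C 2 setT (fun s => Y s 0 a)) /\
  (forall s, bg_dom B (Y s)).

Definition static_solution (Y : 'rV[R]_p -> 'rV[R]_n) : Prop :=
  configuration Y /\ equations_of_motion (static_field Y).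

Definition static_gradient (Y : 'rV[R]_p -> 'rV[R]_n) (s : 'rV[R]_p) :
  'M[R]_(1 + p, n) := gradient (static_field Y) (row_mx (0 : 'rV[R]_1) s).

(* The coordinate s_i ranges over D i. *)
Definition energy (D : 'I_p -> set R) (Y : 'rV[R]_p -> 'rV[R]_n) : \bar R :=
  (T%:E * box_integral D (fun s =>
     (dbi_density (Y s) (static_gradient Y s) - dbi_density (Y s) 0)%:E))%E.

Definition rescale (k : 'I_p) (lam : R) (Y : 'rV[R]_p -> 'rV[R]_n) :
    'rV[R]_p -> 'rV[R]_n :=
  fun s => Y (\row_i (if i == k then lam * s 0 i else s 0 i)).

(* (Local) minimum of the energy along every one-parameter deformation [Z] of
   [Y] (with Z 1 = Y) in the class [defs]. *)
Definition energy_minimum (D : 'I_p -> set R)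
    (defs : set (R -> 'rV[R]_p -> 'rV[R]_n)) (Y : 'rV[R]_p -> 'rV[R]_n) :=
  forall Z, defs Z -> Z 1 = Y ->
    \forall lam \near (1 : R), (energy D Y <= energy D (Z lam))%E.

Definition soliton (D : 'I_p -> set R)
    (defs : set (R -> 'rV[R]_p -> 'rV[R]_n)) (Y : 'rV[R]_p -> 'rV[R]_n) :=
  [/\ static_solution Y, energy D Y \is a fin_num & energy_minimum D defs Y].

Definition d_x (y : R -> 'rV[R]_n) (a : 'I_n) (x : R) : R :=
  derive1 (fun t => y t 0 a) x.

(* 1 + G^{xx} G_ab d_xY^a d_xY^b for scalars Y(s) = y(x), x = s_k. *)
Definition stretch (k : 'I_p) (y : R -> 'rV[R]_n) (x : R) : R :=
  1 + invmx (bg_G B (y x)) (space k) (space k)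
      * \sum_a \sum_b bg_H B (y x) a b * d_x y a x * d_x y b x.

Definition energy_integrand (k : 'I_p) (y : R -> 'rV[R]_n) (x : R) : R :=
  expR (- (eps * bg_phi B (y x))) *
  (Num.sqrt ((- \det (bg_G B (y x))) * stretch k y x)
   - Num.sqrt (- \det (bg_G B (y x)))).

Definition variation_integrand (k : 'I_p) (y : R -> 'rV[R]_n) (x : R) : R :=
  expR (- (eps * bg_phi B (y x))) *
  Num.sqrt ((- \det (bg_G B (y x))) / stretch k y x) *
  (Num.sqrt (stretch k y x) - 1).

End DiracBornInfeld.

(* Main.v *)
Require Import Defs.
From HB Require Import structures.
From mathcomp Require Import all_boot all_order all_algebra.
From mathcomp Require Import all_classical all_reals all_analysis.
From mathcomp Require Import perm measurable_realfun ring lra.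
Import Order.TTheory GRing.Theory Num.Theory.
Import numFieldNormedType.Exports.
Local Open Scope classical_set_scope.
Local Open Scope ring_scope.

(* Write q for the squared gradient G^{xx} G_ab d_xY^a d_xY^b, h for the energy
   density of the trivial configuration, and r = sqrt (1 + q).  Substituting
   u = lam x shows that E(lam) is a constant (tension times transverse volume)
   times the integral of h (sqrt (1 + lam^2 q) - 1) / lam.  Near lam = 1 this
   integrand differs from its first-order expansion, whose slope is
   h (r - 1) / r, by at most 2 (lam - 1)^2 h (r - 1); integrating this bound
   gives dE/dlam at 1 without any theorem on differentiation under the
   integral.  The slope is nonnegative and positive wherever the gradient does
   not vanish, because G^{xx} > 0: in a Lorentzian metric a covector orthogonal
   to a timelike one is spacelike. *)

(** * Lorentzian linear algebra *)

(** A quantitative form of Cauchy-Schwarz. With V and W the sums of squares of v and w, expanding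
    the sum of the squares of v0 w_i - w0 v_i and using v0 w0 = v . w gives v0^2 (W - w0^2) >= w0^2
    (v0^2 - V), and the right side is positive once w0 is nonzero. The case w0 = 0 is separate:
    there w has a nonzero component. *)
Lemma minkowski_orthogonal (R : realFieldType) (I : finType) (v0 w0 : R)
  (v w : I -> R) :
  \sum_i v i ^+ 2 < v0 ^+ 2 -> v0 * w0 = \sum_i v i * w i ->
  (w0 != 0 \/ exists i, w i != 0) -> w0 ^+ 2 < \sum_i w i ^+ 2.
Proof.
move=> vt vw wn0.
have v02 : 0 < v0 ^+ 2.
  by apply: le_lt_trans vt; apply: sumr_ge0 => i _; exact: sqr_ge0.
have [w00|w00] := eqVneq w0 0.
  case: wn0 => [|[i wi]]; first by rewrite w00 eqxx.
  rewrite w00 expr0n /= (bigD1 i)//= ltr_pwDl//.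
    by rewrite lt0r sqrf_eq0 wi sqr_ge0.
  by apply: sumr_ge0 => j _; exact: sqr_ge0.
have w02 : 0 < w0 ^+ 2 by rewrite lt0r sqrf_eq0 w00 sqr_ge0.
have : 0 <= \sum_i (v0 * w i - w0 * v i) ^+ 2.
  by apply: sumr_ge0 => i _; exact: sqr_ge0.
rewrite (eq_bigr (fun i => v0 ^+ 2 * w i ^+ 2 - 2 * v0 * w0 * (v i * w i)
  + w0 ^+ 2 * v i ^+ 2)); last by move=> i _; ring.
rewrite big_split sumrB /= -!mulr_sumr -vw.
set W := \sum_i w i ^+ 2; set V := \sum_i v i ^+ 2; rewrite -/V in vt.
move=> H; rewrite -subr_gt0 -(pmulr_rgt0 _ v02).
have : 0 < w0 ^+ 2 * (v0 ^+ 2 - V) by rewrite mulr_gt0// subr_gt0.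
by move: H; rewrite !expr2; lra.
Qed.

Lemma minkowski_form (R : realType) (p m : nat) (Q : 'M[R]_(m, 1 + p)) i j :
  (Q *m Defs.minkowski R p *m Q^T) i j =
  - (Q i time * Q j time) + \sum_a Q i (Defs.space a) * Q j (Defs.space a).
Proof.
rewrite mxE big_split_ord big_ord1 /=; congr (_ + _).
  by rewrite /Defs.minkowski mul_mx_diag !mxE eqxx; ring.
apply: eq_bigr => a _; rewrite /Defs.minkowski mul_mx_diag !mxE.
by rewrite (eq_rlshift a) mulr1.
Qed.

Lemma lorentzian_det_lt0 (R : realType) (p : nat) (g : 'M[R]_(1 + p)) :
  lorentzian g -> \det g < 0.
Proof.
move=> [P Pu ->]; rewrite !det_mulmx det_tr.
have -> : \det (Defs.minkowski R p) = -1.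
  rewrite /Defs.minkowski det_diag big_split_ord big_ord1 /= mxE eqxx big1 ?mulr1//.
  by move=> a _; rewrite mxE eq_rlshift.
move: Pu; rewrite unitmxE unitfE => Pu.
rewrite mulrN1 mulNr oppr_lt0 -expr2 lt0r sqr_ge0 andbT sqrf_eq0 //.
Qed.

Lemma lorentzian_unitmx (R : realType) (p : nat) (g : 'M[R]_(1 + p)) :
  lorentzian g -> g \in unitmx.
Proof. by move=> /lorentzian_det_lt0 g0; rewrite unitmxE unitfE lt_eqF. Qed.

Lemma minkowski_sqr (R : realType) (p : nat) :
  Defs.minkowski R p *m Defs.minkowski R p = 1%:M.
Proof.
apply/matrixP => i j; rewrite /Defs.minkowski mul_diag_mx !mxE.
by case: eqP => _; case: eqP => _; rewrite ?mulr1n ?mulr0n ?mulr0 ?mul1r ?mulN1r ?opprK.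
Qed.

(** Writing g = P^T eta P, the inverse metric is Q eta Q^T with Q = P^{-1}, so its entries are
    Minkowski products of rows of Q. Row [time] is timelike because g_{00} g^{00} = 1, row [space k]
    is orthogonal to it because g_{00} g^{0k} = 0, and it is nonzero because Q is invertible;
    [minkowski_orthogonal] then makes it spacelike. *)
Lemma lorentzian_invmx_space_gt0 (R : realType) (p : nat) (g : 'M[R]_(1 + p))
  (k : 'I_p) :
  lorentzian g -> g time time < 0 -> (forall i, g time (Defs.space i) = 0) ->
  0 < invmx g (Defs.space k) (Defs.space k).
Proof.
move=> lg gtt gts; have gu := lorentzian_unitmx _ _ _ lg.
(* Row [time] of g is zero off the diagonal, so reading g g^{-1} = 1 along it leaves a single
   product. *)
have gE j : g time time * invmx g time j = (time == j)%:R.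
  have /matrixP/(_ time j) := mulmxV gu.
  rewrite !mxE big_split_ord big_ord1 /= [X in _ + X]big1 ?addr0//.
  by move=> a _; rewrite gts mul0r.
case: lg => P Pu gP.
pose Q := invmx P.
have gQ : invmx g = Q *m Defs.minkowski R p *m Q^T.
  apply: (can_inj (mulKmx gu)); rewrite mulmxV// gP.
  rewrite -!mulmxA (mulmxA P) mulmxV// mul1mx (mulmxA (Defs.minkowski R p)).
  by rewrite minkowski_sqr mul1mx -trmx_mul mulVmx// trmx1.
rewrite gQ minkowski_form addrC subr_gt0 -expr2.
under eq_bigr do rewrite -expr2.
apply: (@minkowski_orthogonal _ _ (Q time time) _ (fun a => Q time (Defs.space a))).
- have : invmx g time time < 0.
    have := gE time; rewrite eqxx => gg.
    by rewrite -(nmulr_rgt0 _ gtt) gg.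
  rewrite gQ minkowski_form addrC subr_lt0 -expr2.
  by under eq_bigr do rewrite -expr2.
- have := gE (Defs.space k); rewrite eq_lrshift /= => /eqP.
  rewrite mulf_eq0 lt_eqF//= gQ minkowski_form addrC subr_eq0 eq_sym.
  by move/eqP.
(* A vanishing row of Q would contradict the diagonal entry 1 of Q P = 1. *)
have /matrixP/(_ (Defs.space k) (Defs.space k)) := mulVmx Pu.
rewrite -/Q !mxE eqxx => QP.
have [j Qj] : exists j, Q (Defs.space k) j != 0.
  apply/existsP; rewrite -negb_forall; apply/negP => /forallP H.
  move: QP; rewrite big1 => [|j _]; first by move/eqP; rewrite eq_sym oner_eq0.
  by rewrite (eqP (H j)) mul0r.
move: Qj; case: (split_ordP j) => a -> Qa; last by right; exists a.
by left; rewrite (ord1 a) in Qa.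
Qed.

(** Expand along row k. The cofactors of that row delete it, so A and B share them, and the change
    in determinant is c times the (k, k) cofactor of A, which is [invmx A k k] times det A. *)
Lemma det_add_diag_entry (F : fieldType) (n : nat) (A B : 'M[F]_n) (k : 'I_n)
  (c : F) :
  A \in unitmx ->
  (forall i j, B i j = A i j + (if (i == k) && (j == k) then c else 0)) ->
  \det B = (1 + invmx A k k * c) * \det A.
Proof.
move=> Au BA.
have cof j : cofactor B k j = cofactor A k j.
  rewrite /cofactor; congr (_ * \det _); apply/matrixP => i l.
  by rewrite !mxE BA eq_sym (negPf (neq_lift _ _)) addr0.
rewrite (expand_det_row B k) (eq_bigr (fun j => A k j * cofactor A k j +
  (if j == k then c * cofactor A k k else 0))); last first.
  move=> j _; rewrite BA eqxx cof mulrDl; congr (_ + _).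
  by case: eqP => [->|]; rewrite ?mul0r.
rewrite big_split -expand_det_row -big_mkcond big_pred1_eq /=.
rewrite mulrDl mul1r /invmx Au !mxE; congr (_ + _).
by move: Au; rewrite unitmxE unitfE => Au; field.
Qed.

Lemma positive_definite_sum (R : realType) (n : nat) (H : 'M[R]_n)
  (v : 'I_n -> R) : positive_definite H ->
  [/\ 0 <= \sum_a \sum_b H a b * v a * v b &
      (exists a, v a <> 0) -> 0 < \sum_a \sum_b H a b * v a * v b].
Proof.
move=> [_ Hp]; pose r : 'rV_n := \row_a v a.
have E : \sum_a \sum_b H a b * v a * v b = (r *m H *m r^T) 0 0.
  rewrite exchange_big mxE; apply: eq_bigr => b _.
  rewrite !mxE mulr_suml; apply: eq_bigr => a _; rewrite !mxE; ring.
rewrite E; split.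
  have [->|/Hp/ltW//] := eqVneq r 0.
  by rewrite !mul0mx mxE.
move=> [a va]; apply: Hp; apply/eqP => /matrixP/(_ 0 a).
by rewrite !mxE.
Qed.

(** * Scaling a one-dimensional energy integral *)

(** W is the volume of the box, possibly infinite; for p = 0 it is 1. *)
Lemma box_integral_cst (R : realType) (p : nat) (D : 'I_p -> set R)
  (hD : forall i, measurable (D i) /\ (0 < lebesgue_measure (D i))%E) :
  exists2 W : \bar R, (0 < W)%E &
    forall c : \bar R, box_integral D (fun=> c) = (c * W)%E.
Proof.
elim: p D hD => [|p IH] D hD; first by exists 1%E => // c; rewrite mule1.
have [W W0 HW] := IH (fun i => D (lift ord0 i)) (fun i => hD _).
exists (W * lebesgue_measure (D ord0))%E.
  by rewrite mule_gt0//; case: (hD ord0).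
move=> c /=; under eq_integral do rewrite HW.
by rewrite integral_cst ?muleA//; case: (hD ord0).
Qed.

(** W is the volume of the box in the directions other than k, possibly infinite. The induction
    peels off the outermost coordinate: either it differs from k and contributes a factor of
    measure, or it is k and the remaining integrals see a constant. *)
Lemma box_integral_coord (R : realType) (p : nat) (D : 'I_p -> set R)
  (hD : forall i, measurable (D i) /\ (0 < lebesgue_measure (D i))%E)
  (k : 'I_p) :
  exists2 W : \bar R, (0 < W)%E &
    forall f : R -> R, measurable_fun setT f -> (forall x, 0 <= f x) ->
      box_integral D (fun s => (f (s 0 k))%:E) =
      (W * \int[lebesgue_measure]_(x in D k) (f x)%:E)%E.
Proof.
elim: p D hD k => [|p IH] D hD k; first by case: k.
case: (unliftP ord0 k) => [j|] ->.
  have [W W0 HW] := IH (fun i => D (lift ord0 i)) (fun i => hD _) j.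
  exists (W * lebesgue_measure (D ord0))%E.
    by rewrite mule_gt0//; case: (hD ord0).
  move=> f mf f0 /=.
  under eq_integral => t _.
    rewrite (_ : (fun v => _) = (fun v : 'rV_p => (f (v 0 j))%:E)); last first.
      apply/funext => v; congr (f _)%:E; rewrite (_ : lift ord0 j = @rshift 1 p j).
        exact: row_mxEr.
      exact: val_inj.
    rewrite HW//; over.
  by rewrite integral_cst 1?muleAC//; case: (hD ord0).
have [W W0 HW] := box_integral_cst _ _ (fun i => D (lift ord0 i)) (fun i => hD _).
exists W => // f mf f0 /=.
under eq_integral => t _.
  rewrite (_ : (fun v => _) = (fun=> (f t)%:E)); last first.
    apply/funext => v; congr (f _)%:E.
    rewrite (_ : ord0 = @lshift 1 p ord0); last exact: val_inj.
    by apply: etrans (row_mxEl _ _ _ _) _; rewrite mxE.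
  rewrite HW; over.
rewrite ge0_integralZr//; first by rewrite muleC.
- by case: (hD ord0).
- apply/measurable_EFinP; exact: measurable_funTS.
- by move=> x _; rewrite lee_fin.
exact: ltW.
Qed.

(* [M] may be +oo (infinite transverse volume), in which case [I = 0] and [c] is
   arbitrary. *)
Lemma mule_fin_num_scalar (R : realType) (M I : \bar R) :
  (0 < M)%E -> (0 <= I)%E -> (M * I)%E \is a fin_num ->
  exists2 c : R, 0 < c & forall (C : R) (J : \bar R),
    (0 <= J)%E -> (J <= C%:E * I)%E ->
    J \is a fin_num /\ (M * J = c%:E * J)%E.
Proof.
move=> M0 I0 MI.
have fI : I \is a fin_num.
  case: I I0 MI => [r| |]//= _; rewrite gt0_muley//.
have fJ (C : R) J : (0 <= J)%E -> (J <= C%:E * I)%E -> J \is a fin_num.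
  move=> J0 JI; rewrite ge0_fin_numE// (le_lt_trans JI)// ltey_eq.
  by rewrite fin_numM.
case: M M0 MI => [m| |]// M0 MI.
  by exists m => // C J J0 JI; split => //; exact: fJ JI.
exists 1 => // C J J0 JI; split; first exact: fJ JI.
have I00 : I = 0%E.
  apply/eqP; rewrite eq_le I0 andbT leNgt; apply/negP => Igt0.
  by move: MI; rewrite gt0_mulye.
suff -> : J = 0%E by rewrite !mule0.
by apply/eqP; rewrite eq_le J0 andbT (le_trans JI)// I00 mule0.
Qed.

(** Dividing the remainder by x - a leaves an error of at most K |x - a|. This turns an integrated
    Taylor estimate directly into a derivative. *)
Lemma is_derive_quadratic (R : realType) (f : R -> R) (a d K r : R) :
  0 < r ->
  (forall x, `|x - a| <= r -> `|f x - f a - (x - a) * d| <= K * (x - a) ^+ 2) ->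
  is_derive a (1 : R) f d.
Proof.
move=> r0 H.
(* The bound at x = a + r already forces this sign. *)
have K0 : 0 <= K.
  have := H (a + r); rewrite addrAC subrr add0r gtr0_norm// lexx => /(_ isT) h.
  have := le_trans (normr_ge0 _) h; rewrite pmulr_lge0// exprn_gt0//.
suff hc : h^-1 *: ((f \o shift a) (h *: (1 : R)) - f a) @[h --> 0^'] --> d.
  by split; [apply/cvg_ex; exists d | exact: cvg_lim].
apply/cvgrPdist_le => e e0.
(* K + 1 in place of K keeps the quotient meaningful when K = 0. *)
have Ke : 0 < e / (K + 1) by rewrite divr_gt0// ltr_wpDl.
near=> h.
have h0 : h != 0 by near: h; exact: nbhs_dnbhs_neq.
have hr : `|h| <= r by near: h; apply: dnbhs0_le.
have he : `|h| <= e / (K + 1) by near: h; apply: dnbhs0_le.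
rewrite /= scaler1 distrC /GRing.scale/=.
have := H (h + a); rewrite addrK => /(_ hr) hh.
have -> : h^-1 * (f (h + a) - f a) - d = h^-1 * (f (h + a) - f a - h * d).
  by rewrite [in RHS]mulrBr mulrA mulVf ?mul1r.
rewrite normrM normfV ler_pdivrMl ?normr_gt0//.
apply: (le_trans hh); rewrite -real_normK ?num_real// expr2 mulrCA.
rewrite ler_wpM2l//; apply: (@le_trans _ _ ((K + 1) * `|h|)).
  by rewrite ler_wpM2r// lerDl.
by rewrite mulrC -ler_pdivlMr// ltr_wpDl.
Unshelve. all: by end_near. Qed.

Lemma le_of_sqr_le (R : realDomainType) (x y : R) :
  0 <= y -> x ^+ 2 <= y ^+ 2 -> x <= y.
Proof. by move=> y0; rewrite !expr2 => h; rewrite leNgt; apply/negP => ?; nra. Qed.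

Section RescaledRoot.
Variables (R : realType) (q l : R).
Hypotheses (q0 : 0 <= q) (l0 : 0 < l).
Let s := Num.sqrt (1 + l ^+ 2 * q).
Let r := Num.sqrt (1 + q).

Let s0 : 0 <= s. Proof. exact: sqrtr_ge0. Qed.
Let s2 : s ^+ 2 = 1 + l ^+ 2 * q.
Proof. by rewrite sqr_sqrtr// addr_ge0// mulr_ge0// sqr_ge0. Qed.
Let r2 : q = r ^+ 2 - 1.
Proof. by rewrite sqr_sqrtr ?addr_ge0//; ring. Qed.
Let r1 : 1 <= r.
Proof. by rewrite -[leLHS]sqrtr1 ler_wsqrtr// lerDl. Qed.
Let r0 : 0 <= r. Proof. exact: le_trans r1. Qed.

Lemma sqrt_rescale_ge0 : 0 <= (s - 1) / l.
Proof.
rewrite divr_ge0 ?(ltW l0)// subr_ge0 -[leLHS]sqrtr1.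
by rewrite ler_wsqrtr// lerDl mulr_ge0// sqr_ge0.
Qed.

(** This domination carries finiteness of the energy from l = 1 to every l > 0. After multiplying by
    l and squaring, the difference of the two sides factors through r - 1 with a nonnegative
    cofactor. *)
Lemma sqrt_rescale_le : (s - 1) / l <= (l + l^-1) * (r - 1).
Proof.
rewrite ler_pdivrMr// mulrAC mulrDl mulVf ?gt_eqF// -expr2 lerBlDl.
have l2 : 0 <= l ^+ 2 by rewrite sqr_ge0.
apply: le_of_sqr_le.
  by rewrite addr_ge0// mulr_ge0// ?subr_ge0// addr_ge0.
rewrite s2 r2 -subr_ge0.
set m := l ^+ 2; rewrite -/m in l2.
have -> : (1 + (m + 1) * (r - 1)) ^+ 2 - (1 + m * (r ^+ 2 - 1)) =
  (r - 1) * (2 + (m ^+ 2 + m + 1) * (r - 1)) by ring.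
have m2 : 0 <= m ^+ 2 by rewrite sqr_ge0.
by rewrite mulr_ge0 ?subr_ge0// addr_ge0// mulr_ge0 ?subr_ge0// !addr_ge0.
Qed.

(* Second-order Taylor bound at l = 1, uniform in q relative to r - 1. It comes
   from [r^2 + d q <= r s <= r^2 + d q + d^2 q / 2] with [d = l - 1]. *)
Lemma sqrt_rescale_quadratic : `|l - 1| <= 2^-1 ->
  `|(s - 1) / l - (r - 1) - (l - 1) * ((r - 1) / r)| <=
    2 * (l - 1) ^+ 2 * (r - 1).
Proof.
move=> hl; set d := l - 1.
have lE : l = 1 + d by rewrite /d; ring.
have l2 : 1 <= 2 * l by move: hl; rewrite ler_norml => /andP[]; lra.
have /andP[dl du] : - 2^-1 <= d <= 2^-1 by rewrite -ler_norml.
have d2 : 0 <= d ^+ 2 by rewrite sqr_ge0.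
have rs2 : (r * s) ^+ 2 = r ^+ 2 * (r ^+ 2 + 2 * d * q + d ^+ 2 * q).
  by rewrite exprMn s2 lE r2; ring.
have rgt0 : 0 < r by exact: lt_le_trans r1.
have lo : r ^+ 2 + d * q <= r * s.
  apply: le_of_sqr_le; first exact: mulr_ge0.
  rewrite rs2 -subr_ge0 [X in 0 <= X](_ : _ = d ^+ 2 * q).
    exact: mulr_ge0.
  by rewrite r2; ring.
have up : r * s <= r ^+ 2 + d * q + d ^+ 2 * q / 2.
  apply: le_of_sqr_le.
    rewrite addr_ge0//; last by rewrite divr_ge0// mulr_ge0.
    have : 0 <= (d + 1) * q by rewrite mulr_ge0//; lra.
    by rewrite [in r ^+ 2](_ : r ^+ 2 = 1 + q); [lra|rewrite r2; ring].
  rewrite rs2 -subr_ge0.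
  rewrite [X in 0 <= X](_ : _ = (d * q + d ^+ 2 * q / 2) ^+ 2).
    exact: sqr_ge0.
  by field.
set X := (X in `|X|).
(* Clearing both denominators makes the expression linear in r s, the quantity just bounded. *)
have XE : l * r * X = r * s - r - l * (r - 1) * (r + l - 1).
  by rewrite /X /d; field; rewrite !gt_eqF.
have lr0 : 0 < l * r by exact: mulr_gt0.
(* The two bounds on r s yield -(r - 1) d^2 <= l r X <= (r - 1)^2 d^2 / 2; both ends are absorbed
   using r >= 1. *)
have hX : `|l * r * X| <= (r - 1) * d ^+ 2 * r.
  rewrite XE lE r2 in lo up *; rewrite ler_norml.
  apply/andP; split.
  - have : 0 <= (r - 1) ^+ 2 * d ^+ 2 by rewrite mulr_ge0// sqr_ge0.
    nra.
  - have : 0 <= (r - 1) * d ^+ 2 by rewrite mulr_ge0// subr_ge0.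
    nra.
rewrite normrM gtr0_norm// -ler_pdivlMl// in hX; apply: (le_trans hX).
rewrite ler_pdivrMl//.
(* The factor 2 in the bound pays for 1 / l, since l >= 1/2. *)
have : 0 <= (2 * l - 1) * ((r - 1) * d ^+ 2 * r).
  by rewrite mulr_ge0 ?subr_ge0// mulr_ge0// mulr_ge0// subr_ge0.
nra.
Qed.

End RescaledRoot.

Lemma integral_rescale (R : realType) (G : R -> R) (l : R) :
  0 < l -> continuous G -> (forall x, 0 <= G x) ->
  (\int[lebesgue_measure]_x (G (l * x))%:E =
   \int[lebesgue_measure]_x (G x / l)%:E)%E.
Proof.
move=> l0 cG G0; pose F (x : R) := l * x.
have F1 x : is_derive x (1 : R) F l.
  by apply: is_derive_eq; rewrite [LHS]scaler1.
have FE : F^`()%classic = cst l.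
  by apply/funext => x; rewrite derive1E derive_val.
rewrite [RHS](@increasing_ge0_integration_by_substitutionT _ F (fun x => G x / l)).
- apply: eq_integral => x _; rewrite FE /=; congr (_%:E).
  by rewrite -[RHS]/(G (F x) / l * l) divfK// gt_eqF.
- by move=> x y; rewrite /F ltr_pM2l.
- by rewrite FE => x; exact: cvg_cst.
- by rewrite FE; exact: is_cvg_cst.
- by rewrite FE; exact: is_cvg_cst.
- by move=> x; exact: ex_derive.
- by apply: gt0_cvgMrNy => //; exact: cvg_id.
- by apply: gt0_cvgMry => //; exact: cvg_id.
- by move=> x; apply: cvgM; [exact: cG|exact: cvg_cst].
- by move=> x; rewrite divr_ge0// ltW.
Qed.

Lemma integral_gt0 (R : realType) (f : R -> R) (x : R) :
  continuous f -> (forall x, 0 <= f x) -> 0 < f x ->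
  (0 < \int[lebesgue_measure]_x (f x)%:E)%E.
Proof.
move=> cf f0 fx0.
have mf : measurable_fun setT f by exact: continuous_measurable_fun.
have : \forall t \near x, f x / 2 <= f t.
  have /cvgrPdist_le/(_ (f x / 2)) := cf x.
  rewrite divr_gt0// => /(_ isT); apply: filterS => t.
  by rewrite ler_norml => /andP[_]; lra.
move=> /nbhs_ballP[e /= e0 He].
(* Half the radius keeps this closed interval inside the ball where f >= f x / 2. *)
set I := `[x - e / 2, x + e / 2]%classic.
have mI : measurable I by exact: measurable_itv.
apply: (@lt_le_trans _ _ (\int[lebesgue_measure]_(t in I) (f x / 2)%:E)%E).
  rewrite integral_cst//= lebesgue_measure_itv/= lte_fin ifT; last by lra.
  by rewrite -EFinB -EFinM lte_fin mulr_gt0 ?divr_gt0//; lra.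
apply: (@le_trans _ _ (\int[lebesgue_measure]_(t in I) (f t)%:E)%E).
  apply: ge0_le_integral => //=.
  - by move=> t _; rewrite lee_fin divr_ge0.
  - by apply/measurable_EFinP; exact: measurable_funTS.
  - move=> t; rewrite /I /= in_itv/= => /andP[tl tu]; rewrite lee_fin.
    by apply: He; rewrite /ball/= ltr_norml; apply/andP; split; lra.
apply: ge0_subset_integral => //.
- by apply/measurable_EFinP.
- by move=> t _; rewrite lee_fin.
Qed.

Section ScalingFamily.
Variables (R : realType) (h q : R -> R).
Hypotheses (ch : continuous h) (cq : continuous q).
Hypotheses (h0 : forall u, 0 < h u) (q0 : forall u, 0 <= q u).

(** The energy density in the variable u = l x: l^2 comes from the two derivatives and 1 / l is the
    Jacobian. *)
Definition rescaled_energy (l u : R) : R :=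
  h u * ((Num.sqrt (1 + l ^+ 2 * q u) - 1) / l).

(** The derivative of [rescaled_energy] in l at 1: with r = sqrt (1 + q) it is h (q / r - (r - 1)),
    simplified by q = r^2 - 1. *)
Definition energy_variation (u : R) : R :=
  h u * ((Num.sqrt (1 + q u) - 1) / Num.sqrt (1 + q u)).

Local Notation mu := lebesgue_measure.
Local Notation E := rescaled_energy.
Local Notation V := energy_variation.

Let E1 u : E 1 u = h u * (Num.sqrt (1 + q u) - 1).
Proof. by rewrite /E expr1n mul1r divr1. Qed.

Let r1 u : 1 <= Num.sqrt (1 + q u).
Proof. by rewrite -[leLHS]sqrtr1 ler_wsqrtr// lerDl. Qed.

Lemma rescaled_energy_ge0 l u : 0 < l -> 0 <= E l u.
Proof. by move=> l0; rewrite mulr_ge0 ?sqrt_rescale_ge0// ltW. Qed.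

Lemma energy_variation_ge0 u : 0 <= V u.
Proof. by rewrite mulr_ge0 ?(ltW (h0 _))// divr_ge0 ?sqrtr_ge0// subr_ge0. Qed.

Let E_le l u : 0 < l -> E l u <= (l + l^-1) * E 1 u.
Proof.
by move=> l0; rewrite E1 mulrCA ler_wpM2l ?(ltW (h0 _))// sqrt_rescale_le.
Qed.

Let V_le u : V u <= 1 * E 1 u.
Proof.
rewrite mul1r E1 ler_wpM2l ?(ltW (h0 _))// ler_piMr ?subr_ge0//.
by rewrite invf_le1// (lt_le_trans _ (r1 u)).
Qed.

Lemma continuous_rescaled_energy l : continuous (E l).
Proof.
move=> u; apply: cvgM; first exact: ch.
apply: cvgM; last exact: cvg_cst.
apply: cvgB; last exact: cvg_cst.
apply: continuous_comp; last exact: sqrt_continuous.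
apply: cvgD; first exact: cvg_cst.
by apply: cvgM; [exact: cvg_cst|exact: cq].
Qed.

Lemma continuous_energy_variation : continuous V.
Proof.
have cr : continuous (fun u => Num.sqrt (1 + q u)).
  move=> u; apply: continuous_comp; last exact: sqrt_continuous.
  by apply: cvgD; [exact: cvg_cst|exact: cq].
move=> u; apply: cvgM; first exact: ch.
apply: cvgM; first by apply: cvgB; [exact: cr|exact: cvg_cst].
by apply: cvgV; [rewrite gt_eqF// (lt_le_trans _ (r1 u))|exact: cr].
Qed.

#[local] Hint Resolve continuous_rescaled_energy continuous_energy_variation
  rescaled_energy_ge0 energy_variation_ge0 : core.

Lemma energy_variation_gt0 u : 0 < q u -> 0 < V u.
Proof.
move=> qu; have r0 : 0 < Num.sqrt (1 + q u) by exact: lt_le_trans (r1 u).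
rewrite mulr_gt0// divr_gt0// subr_gt0 -[ltLHS]sqrtr1.
by rewrite ltr_sqrt ?ltrDl// ltr_wpDr.
Qed.

Let integral_le (f : R -> R) C : continuous f -> 0 <= C ->
  (forall u, 0 <= f u) -> (forall u, f u <= C * E 1 u) ->
  (\int[mu]_u (f u)%:E <= C%:E * \int[mu]_u (E 1 u)%:E)%E.
Proof.
move=> cf C0 f0 fC.
have mE : measurable_fun setT (EFin \o E 1).
  by apply/measurable_EFinP; exact: continuous_measurable_fun.
rewrite -ge0_integralZl//; last by move=> u _; rewrite lee_fin rescaled_energy_ge0.
apply: ge0_le_integral => //.
- by move=> u _; rewrite lee_fin.
- by apply/measurable_EFinP; exact: continuous_measurable_fun.
- exact: measurable_funeM.
- by move=> u _; rewrite -EFinM lee_fin.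
Qed.

Variables (M : \bar R).
Hypotheses (M0 : (0 < M)%E).
Hypothesis finE : (M * \int[mu]_u (E 1 u)%:E)%E \is a fin_num.

(** Since M may be infinite, M times an integral is not directly linear in the integrand. One finite
    c replaces M simultaneously for all continuous nonnegative integrands dominated by a multiple of
    [E 1], so that real integration theory applies to all of them. *)
Lemma scaling_family_scalar : exists2 c : R, 0 < c &
  forall f : R -> R, continuous f -> (forall u, 0 <= f u) ->
    (exists2 C, 0 <= C & forall u, f u <= C * E 1 u) ->
    mu.-integrable setT (EFin \o f) /\
    (M * \int[mu]_u (f u)%:E = (c * \int[mu]_u f u)%:E)%E.
Proof.
have I0 : (0 <= \int[mu]_u (E 1 u)%:E)%E.
  by apply: integral_ge0 => u _; rewrite lee_fin rescaled_energy_ge0.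
have [c c0 Hc] := mule_fin_num_scalar _ _ _ M0 I0 finE.
exists c => // f cf f0 [C C0 fC].
have J0 : (0 <= \int[mu]_u (f u)%:E)%E.
  by apply: integral_ge0 => u _; rewrite lee_fin.
have [fJ ->] := Hc C _ J0 (integral_le f C cf C0 f0 fC).
split; last by rewrite EFinM /Rintegral fineK.
apply/integrableP; split.
  by apply/measurable_EFinP; exact: continuous_measurable_fun.
under eq_integral do rewrite gee0_abs ?lee_fin//.
by rewrite ltey_eq fJ.
Qed.

Lemma rescaled_energy_fin_num l : 0 < l ->
  (M * \int[mu]_u (E l u)%:E)%E \is a fin_num.
Proof.
move=> l0; have [c _ Hc] := scaling_family_scalar.
have [||_ ->//] := Hc (E l) (continuous_rescaled_energy l).
  by move=> u; exact: rescaled_energy_ge0.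
by exists (l + l^-1) => [|u]; [by rewrite addr_ge0 ?invr_ge0 ?(ltW l0)|exact: E_le].
Qed.

Lemma energy_variation_fin_num : (M * \int[mu]_u (V u)%:E)%E \is a fin_num.
Proof.
have [c _ Hc] := scaling_family_scalar.
by have [||_ ->//] := Hc V continuous_energy_variation; last by exists 1.
Qed.

Lemma integral_energy_variation_gt0 u : 0 < q u -> 0 < fine (M * \int[mu]_u (V u)%:E).
Proof.
move=> qu; have [c c0 Hc] := scaling_family_scalar.
have [|iV ->] := Hc V continuous_energy_variation energy_variation_ge0; first by exists 1.
rewrite /= mulr_gt0// fine_gt0//; apply/andP; split.
  apply: (integral_gt0 _ _ u continuous_energy_variation energy_variation_ge0).
  exact: energy_variation_gt0.
by rewrite ltey_eq integrable_fin_num.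
Qed.

Lemma is_derive_rescaled_energy :
  is_derive (1 : R) (1 : R) (fun l => fine (M * \int[mu]_u (E l u)%:E))
    (fine (M * \int[mu]_u (V u)%:E)).
Proof.
have [c c0 Hc] := scaling_family_scalar.
have HE l : 0 < l -> mu.-integrable setT (EFin \o E l) /\
    (M * \int[mu]_u (E l u)%:E = (c * \int[mu]_u E l u)%:E)%E.
  move=> l0; apply: Hc => [|u|].
  - exact: continuous_rescaled_energy.
  - exact: rescaled_energy_ge0.
  - exists (l + l^-1) => [|u]; last exact: E_le.
    by rewrite addr_ge0 ?invr_ge0 ?(ltW l0).
have [iV ->] : mu.-integrable setT (EFin \o V) /\
    (M * \int[mu]_u (V u)%:E = (c * \int[mu]_u V u)%:E)%E.
  by apply: Hc => //; exists 1.
(* The constant is the pointwise bound of [sqrt_rescale_quadratic] integrated against h and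
   multiplied by c; the radius 1/2 is the range of that bound. *)
apply: (@is_derive_quadratic _ _ _ _ (2 * c * \int[mu]_u E 1 u) 2^-1) => //.
move=> l hl.
have l0 : 0 < l by move: hl; rewrite ler_norml; lra.
have [iE ->] := HE l l0; have [iE1 ->] := HE 1 ltr01 => /=.
have iVl : mu.-integrable setT (EFin \o (fun u => (l - 1) * V u)).
  exact: (integrableZl measurableT _ iV).
have iEB : mu.-integrable setT (EFin \o (fun u => E l u - E 1 u)).
  exact: (integrableB measurableT iE iE1).
have iD : mu.-integrable setT (EFin \o (fun u => E l u - E 1 u - (l - 1) * V u)).
  exact: (integrableB measurableT iEB iVl).
rewrite [X in `|X|](_ : _ = c * \int[mu]_u (E l u - E 1 u - (l - 1) * V u)).
  rewrite normrM gtr0_norm//.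
  rewrite [leRHS](_ : _ = c * \int[mu]_u (2 * (l - 1) ^+ 2 * E 1 u)); last first.
    by rewrite RintegralZl//; ring.
  rewrite ler_wpM2l ?(ltW c0)//; apply: (le_trans (le_normr_Rintegral _ _)) => //.
  apply: le_Rintegral => //.
  - exact: integrable_norm.
  - exact: (integrableZl measurableT _ iE1).
  move=> u _; rewrite E1 /E /V.
  set a := Num.sqrt _; set b := Num.sqrt _.
  rewrite [X in `|X|](_ : _ = h u * ((a - 1) / l - (b - 1) - (l - 1) * ((b - 1) / b))).
    rewrite normrM gtr0_norm// [leRHS]mulrCA ler_wpM2l ?(ltW (h0 _))//.
    exact: sqrt_rescale_quadratic.
  by ring.
rewrite RintegralB// RintegralB// RintegralZl//; ring.
Qed.

End ScalingFamily.

(** * Fields depending on one worldvolume coordinate *)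

(** An equality of functions of h, so that it can be rewritten under the limit both for values of
    partial derivatives and for derivability. *)
Lemma slice_quotient (R : realType) (m : nat) (K mu : 'I_m) (f : R -> R)
  (xi : 'rV[R]_m) :
  (fun h : R => h^-1 *: (((fun zeta : 'rV[R]_m => f (zeta 0 K)) \o shift xi)
    (h *: delta_mx 0 mu) - f (xi 0 K))) =
  (fun h : R => h^-1 *: ((f \o shift (xi 0 K)) (h *: ((mu == K)%:R : R)) - f (xi 0 K))).
Proof. by apply/funext => h /=; rewrite !mxE eqxx /= eq_sym. Qed.

Lemma partial_slice (R : realType) (m : nat) (K mu : 'I_m) (f : R -> R)
  (xi : 'rV[R]_m) :
  partial mu (fun zeta : 'rV[R]_m => f (zeta 0 K)) xi =
  if mu == K then (f^`()%classic) (xi 0 K) else 0.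
Proof.
rewrite /partial /derive slice_quotient; case: eqP => _.
  by rewrite derive1E.
rewrite (_ : (fun h : R => _) = cst 0); first exact: lim_cst.
by apply/funext => h /=; rewrite mulr0n scaler0 add0r subrr scaler0.
Qed.

Lemma derivable_slice (R : realType) (m : nat) (K : 'I_m) (f : R -> R)
  (xi : 'rV[R]_m) :
  derivable (fun zeta : 'rV[R]_m => f (zeta 0 K)) xi (delta_mx 0 K) ->
  derivable f (xi 0 K) 1.
Proof. by rewrite /derivable slice_quotient eqxx. Qed.

Lemma continuous_det (R : realType) (T : topologicalType) (n : nat)
  (A : T -> 'M[R]_n) :
  (forall i j, continuous (fun x => A x i j)) -> continuous (fun x => \det (A x)).
Proof.
move=> cA; apply: continuous_big => [|s _].
  by move=> x; exact: add_continuous.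
move=> x; apply: cvgM; first exact: cvg_cst.
have cP : continuous (fun x => \prod_i A x i (s i)).
  apply: continuous_big => [|i _]; first by move=> z; exact: mul_continuous.
  exact: cA.
exact: cP.
Qed.

(** By Cramer's formula the entry is a cofactor divided by a determinant that never vanishes. *)
Lemma continuous_invmx_entry (R : realType) (T : topologicalType) (n : nat)
  (A : T -> 'M[R]_n) (i j : 'I_n) :
  (forall x, A x \in unitmx) ->
  (forall i j, continuous (fun x => A x i j)) ->
  continuous (fun x => invmx (A x) i j).
Proof.
move=> uA cA.
rewrite (_ : (fun x => _) =
    (fun x => (\det (A x))^-1 * ((-1) ^+ (j + i) * \det (row' j (col' i (A x)))))).
  move=> x; apply: cvgM.
    apply: cvgV; first by have := uA x; rewrite unitmxE unitfE.
    exact: continuous_det.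
  apply: cvgM; first exact: cvg_cst.
  apply: (continuous_det _ _ _ (fun x => row' j (col' i (A x)))) => a b.
  by under eq_fun do rewrite !mxE; exact: cA.
by apply/funext => x; rewrite /invmx uA !mxE.
Qed.

Section OneCoordinate.
Variables (R : realType) (p n : nat) (T eps : R) (B : background R p n).
Hypothesis hB : static_background B.
Variables (k : 'I_p).

(** The gradient matrix has only row [space k] nonzero, so the induced metric differs from the
    background one in a single diagonal entry and [det_add_diag_entry] gives its determinant. *)
Lemma energy_one_coordinate (D : 'I_p -> set R) (Y : 'rV[R]_p -> 'rV[R]_n)
  (y : R -> 'rV[R]_n) :
  (forall s, bg_dom B (Y s)) -> (forall s, Y s = y (s 0 k)) ->
  energy T eps B D Y =
    (T%:E * box_integral D
       (fun s => (energy_integrand eps B k y (s 0 k))%:E))%E.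
Proof.
move=> domY Yy; case: hB => _ _ _ _ hdom.
congr (_ * box_integral D _)%E; apply/funext => s; congr (_%:E).
have [lG _ _ _] := hdom _ (domY s).
have gradE mu a : static_gradient Y s mu a =
    if mu == Defs.space k then d_x y a (s 0 k) else 0.
  rewrite mxE (_ : (fun zeta => _) = (fun zeta : 'rV_(1 + p) =>
      (fun t => y t 0 a) (zeta 0 (Defs.space k)))).
    by rewrite (partial_slice _ _ _ _ (fun t => y t 0 a)) row_mxEr.
  by apply/funext => zeta; rewrite /static_field Yy mxE.
have G0 : induced_metric B (Y s) 0 = bg_G B (Y s).
  apply/matrixP => mu nu; rewrite mxE big1 ?addr0// => a _.
  by rewrite big1// => b _; rewrite !mxE mulr0.
have detE : \det (induced_metric B (Y s) (static_gradient Y s)) =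
    \det (bg_G B (Y s)) * stretch B k y (s 0 k).
  rewrite mulrC /stretch -Yy; apply: det_add_diag_entry.
    exact: lorentzian_unitmx.
  move=> mu nu; rewrite mxE; congr (_ + _).
  under eq_bigr do under eq_bigr do rewrite !gradE.
  case: (mu =P Defs.space k) => _; case: (nu =P Defs.space k) => _ //=;
    by rewrite big1// => a _; rewrite big1// => b _; rewrite ?mulr0 ?mul0r.
by rewrite /dbi_density /energy_integrand -Yy G0 detE -mulrBr mulNr.
Qed.

Section Solution.
Variables (Y : 'rV[R]_p -> 'rV[R]_n) (y : R -> 'rV[R]_n).
Hypotheses (cY : configuration B Y) (Yy : forall s, Y s = y (s 0 k)).

(** The k-th coordinate axis. Along it Y restricts to y, which is how y inherits regularity from
    Y. *)
Let line (x : R) : 'rV[R]_p := x *: delta_mx 0 k.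

Let lineE x : line x 0 k = x.
Proof. by rewrite /line !mxE !eqxx mulr1. Qed.

Let line_cont : continuous line.
Proof. exact: scalel_continuous. Qed.

Let domy x : bg_dom B (y x).
Proof. by rewrite -(lineE x) -Yy; case: cY. Qed.

Let YaE a : (fun s => Y s 0 a) = (fun s : 'rV_p => (fun t => y t 0 a) (s 0 k)).
Proof. by apply/funext => s; rewrite Yy. Qed.

Lemma derivable_profile a x : derivable (fun t => y t 0 a) x 1.
Proof.
rewrite -{1}(lineE x); apply: derivable_slice; rewrite -(YaE a).
by apply: diff_derivable; case: cY => /(_ a)[h _] _; exact: h.
Qed.

Lemma continuous_d_x a : continuous (d_x y a).
Proof.
have -> : d_x y a = partial k (fun s => Y s 0 a) \o line.
  by apply/funext => x /=; rewrite YaE (partial_slice _ _ _ _ (fun t => y t 0 a)) eqxx lineE.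
move=> x; apply: continuous_comp; first exact: line_cont.
by case: cY => /(_ a)[_ /(_ k)[h _]] _; apply/differentiable_continuous/h.
Qed.

Let continuous_profile : continuous y.
Proof.
move=> x; apply: differentiable_continuous; apply/derivable1_diffP.
by apply/derivable_mxP => i a; rewrite (ord1 i); exact: derivable_profile.
Qed.

Let continuous_bg (f : 'rV[R]_n -> R) :
  class_C 1 (bg_dom B) f -> continuous (f \o y).
Proof.
move=> [df _] x; apply: continuous_comp; first exact: continuous_profile.
by apply: differentiable_continuous; exact: df.
Qed.

(** This is the q, and [rest_density] the h, to which the scaling family is applied. *)
Definition gradient_sqr (x : R) : R :=
  invmx (bg_G B (y x)) (Defs.space k) (Defs.space k)
    * \sum_a \sum_b bg_H B (y x) a b * d_x y a x * d_x y b x.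

Definition rest_density (x : R) : R :=
  expR (- (eps * bg_phi B (y x))) * Num.sqrt (- \det (bg_G B (y x))).

Lemma continuous_gradient_sqr : continuous gradient_sqr.
Proof.
case: hB => _ cG cH _ hdom x; apply: cvgM.
  apply: (@continuous_invmx_entry _ _ _ (fun x => bg_G B (y x))) => [z|i j].
    by have [lG _ _ _] := hdom _ (domy z); exact: lorentzian_unitmx.
  exact: (continuous_bg (fun y => bg_G B y i j)).
apply: continuous_big => [|a _]; first by move=> z; exact: add_continuous.
apply: continuous_big => [|b _]; first by move=> z; exact: add_continuous.
move=> z; apply: cvgM; last exact: continuous_d_x.
apply: cvgM; last exact: continuous_d_x.
exact: (continuous_bg (fun y => bg_H B y a b)).
Qed.

Lemma continuous_rest_density : continuous rest_density.
Proof.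
case: hB => _ cG _ cphi _ x; apply: cvgM.
  apply: continuous_comp; last exact: continuous_expR.
  apply: cvgN; apply: cvgM; first exact: cvg_cst.
  exact: continuous_bg.
apply: continuous_comp; last exact: sqrt_continuous.
apply: cvgN; apply: (continuous_det _ _ _ (fun x => bg_G B (y x))) => i j.
exact: (continuous_bg (fun y => bg_G B y i j)).
Qed.

Let det_lt0 x : \det (bg_G B (y x)) < 0.
Proof.
case: hB => _ _ _ _ hdom; have [lG _ _ _] := hdom _ (domy x).
exact: lorentzian_det_lt0.
Qed.

Lemma rest_density_gt0 x : 0 < rest_density x.
Proof. by rewrite mulr_gt0 ?expR_gt0// sqrtr_gt0 oppr_gt0. Qed.

Lemma gradient_sqr_ge0 x : 0 <= gradient_sqr x.
Proof.
case: hB => _ _ _ _ hdom; have [lG gtt gts hp] := hdom _ (domy x).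
have [s0 _] := positive_definite_sum _ _ _ (fun a => d_x y a x) hp.
by rewrite mulr_ge0// ltW// lorentzian_invmx_space_gt0.
Qed.

Lemma gradient_sqr_gt0 x : (exists a, d_x y a x <> 0) -> 0 < gradient_sqr x.
Proof.
case: hB => _ _ _ _ hdom; have [lG gtt gts hp] := hdom _ (domy x).
have [_ s0] := positive_definite_sum _ _ _ (fun a => d_x y a x) hp.
by move=> /s0 ?; rewrite mulr_gt0// lorentzian_invmx_space_gt0.
Qed.

Lemma energy_integrandE l x :
  energy_integrand eps B k (fun t => y (l * t)) x =
  rest_density (l * x) * (Num.sqrt (1 + l ^+ 2 * gradient_sqr (l * x)) - 1).
Proof.
have dE a : d_x (fun t => y (l * t)) a x = l * d_x y a (l * x).
  have F1 z : is_derive z (1 : R) (fun t : R => l * t) l.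
    by apply: is_derive_eq; rewrite [LHS]scaler1.
  rewrite /d_x (@derive1_comp _ (fun t => l * t) (fun t => y t 0 a)).
  - by rewrite [X in _ * X]derive1E derive_val mulrC.
  - exact: ex_derive.
  - exact: derivable_profile.
rewrite /energy_integrand /rest_density -mulrA; congr (_ * _).
have -> : stretch B k (fun t => y (l * t)) x = 1 + l ^+ 2 * gradient_sqr (l * x).
  rewrite /stretch /gradient_sqr mulrCA; congr (1 + _ * _).
  rewrite mulr_sumr; apply: eq_bigr => a _; rewrite mulr_sumr.
  by apply: eq_bigr => b _; rewrite !dE; ring.
by rewrite sqrtrM ?mulrBr ?mulr1// oppr_ge0 ltW.
Qed.

Lemma variation_integrandE x :
  variation_integrand eps B k y x =
  energy_variation R rest_density gradient_sqr x.
Proof.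
have s0 : 0 <= stretch B k y x by rewrite addr_ge0// gradient_sqr_ge0.
rewrite /variation_integrand /energy_variation /rest_density -/(stretch B k y x).
by rewrite sqrtrM ?oppr_ge0 ?ltW// sqrtrV//; ring.
Qed.

End Solution.
End OneCoordinate.

(** * Stationarity at a minimum and absence of solitons *)

Lemma is_derive_local_min (R : realType) (f : R -> R) (a d : R) :
  is_derive a (1 : R) f d -> (\forall x \near a, f a <= f x) -> d = 0.
Proof.
move=> [df dE] /nbhs_ballP[e1 /= e10 He1]; apply/eqP/negPn/negP => d0.
move: df; rewrite /derivable => /cvg_ex[l hl].
have : l = d by rewrite -dE; apply/esym/cvg_lim.
move=> ld; rewrite {l}ld in hl.
move/cvgrPdist_lt : hl => /(_ `|d|); rewrite normr_gt0 => /(_ d0).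
move=> /nbhs_ballP[e2 /= e20 He2].
pose e := Num.min e1 e2 / 2.
have e0 : 0 < e by rewrite divr_gt0// lt_min e10.
have ee1 : e < e1 by rewrite ltr_pdivrMr// gt_min; apply/orP; left; lra.
have ee2 : e < e2 by rewrite ltr_pdivrMr// gt_min; apply/orP; right; lra.
(* A step against the sign of d: by minimality its difference quotient is zero or opposite in sign
   to d, hence at distance at least |d| from d. *)
pose h := - Num.sg d * e.
have hn : `|h| = e by rewrite normrM normrN normr_sg d0 mul1r gtr0_norm.
have h0 : h != 0 by rewrite -normr_gt0 hn.
have := He2 h; rewrite /ball/= sub0r normrN hn => /(_ ee2 h0).
have fh : f a <= f (h + a).
  by apply: He1; rewrite /ball/= opprD addrCA subrr addr0 normrN hn.
rewrite scaler1 /GRing.scale/=.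
have {}fh : 0 <= f (h + a) - f a by rewrite subr_ge0.
have [dp|dn|dz] := ltrgt0P d; last by rewrite dz eqxx in d0.
- have : h^-1 * (f (h + a) - f a) <= 0.
    by rewrite mulr_le0_ge0// invr_le0 /h gtr0_sg// mulN1r oppr_le0 ltW.
  by rewrite ltr_norml => ? /andP[]; lra.
- have : 0 <= h^-1 * (f (h + a) - f a).
    by rewrite mulr_ge0// invr_ge0 /h ltr0_sg// opprK mul1r ltW.
  by rewrite ltr_norml => ? /andP[]; lra.
Qed.

Lemma rescale1 (R : realType) (p n : nat) (k : 'I_p)
  (Y : 'rV[R]_p -> 'rV[R]_n) : rescale k 1 Y = Y.
Proof.
apply/funext => s; rewrite /rescale; congr Y; apply/rowP => i.
by rewrite mxE mul1r if_same.
Qed.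

(** M is the tension times the volume of the directions other than k. The same M serves every l
    because [D k] is the whole line, which x -> l x maps onto itself. *)
Lemma energy_rescale (R : realType) (p n : nat) (T eps : R)
  (B : background R p n) (k : 'I_p) (D : 'I_p -> set R)
  (Y : 'rV[R]_p -> 'rV[R]_n) (y : R -> 'rV[R]_n) :
  0 < T -> static_background B -> D k = setT ->
  (forall i, measurable (D i) /\ (0 < lebesgue_measure (D i))%E) ->
  configuration B Y -> (forall s, Y s = y (s 0 k)) ->
  exists2 M : \bar R, (0 < M)%E &
    (forall l, 0 < l -> energy T eps B D (rescale k l Y) =
       (M * \int[lebesgue_measure]_u
          (rescaled_energy R (rest_density R p n eps B y)
             (gradient_sqr R p n B k y) l u)%:E)%E) /\
    (T%:E * box_integral D
       (fun s => (variation_integrand eps B k y (s 0 k))%:E))%E =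
      (M * \int[lebesgue_measure]_u
         (energy_variation R (rest_density R p n eps B y)
            (gradient_sqr R p n B k y) u)%:E)%E.
Proof.
move=> T0 hB hDk hD cY Yy.
set h := rest_density _ _ _ _ _ _; set q := gradient_sqr _ _ _ _ _ _.
have ch : continuous h by exact: (continuous_rest_density _ _ _ _ _ hB k Y).
have cq : continuous q by exact: (continuous_gradient_sqr _ _ _ _ hB k Y).
have h0 : forall u, 0 < h u by exact: (rest_density_gt0 _ _ _ _ _ hB k Y).
have q0 : forall u, 0 <= q u by exact: (gradient_sqr_ge0 _ _ _ _ hB k Y).
have [W W0 HW] := box_integral_coord _ _ D hD k.
exists (T%:E * W)%E; first by rewrite mule_gt0.
split=> [l l0|].
- pose G u := h u * (Num.sqrt (1 + l ^+ 2 * q u) - 1).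
  have cG : continuous G.
    move=> u; apply: cvgM; first exact: ch.
    apply: cvgB; last exact: cvg_cst.
    apply: continuous_comp; last exact: sqrt_continuous.
    apply: cvgD; first exact: cvg_cst.
    by apply: cvgM; [exact: cvg_cst|exact: cq].
  have G0 u : 0 <= G u.
    rewrite mulr_ge0 ?(ltW (h0 _))// subr_ge0 -[leLHS]sqrtr1.
    by rewrite ler_wsqrtr// lerDl mulr_ge0// sqr_ge0.
  rewrite (energy_one_coordinate _ _ _ T eps B hB k D _ (fun t => y (l * t))).
  + have -> : (fun s : 'rV_p =>
        (energy_integrand eps B k (fun t => y (l * t)) (s 0 k))%:E) =
      (fun s : 'rV_p => ((fun x => G (l * x)) (s 0 k))%:E).
      apply/funext => s; congr (_%:E).
      exact: (energy_integrandE _ _ _ _ _ hB k Y).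
    have mG : measurable_fun setT (fun x => G (l * x)).
      apply: continuous_measurable_fun => x.
      apply: (@continuous_comp _ _ _ (fun x => l * x) G); last exact: cG.
      by apply: cvgM; [exact: cvg_cst|exact: cvg_id].
    rewrite (HW _ mG (fun x => G0 (l * x))) hDk integral_rescale// muleA; congr (_ * _)%E.
    by apply: eq_integral => u _; rewrite /rescaled_energy mulrA.
  + by move=> s; case: cY => _; apply.
  + by move=> s; rewrite /rescale Yy mxE eqxx.
have -> : (fun s : 'rV_p => (variation_integrand eps B k y (s 0 k))%:E) =
    (fun s : 'rV_p => (energy_variation R h q (s 0 k))%:E).
  apply/funext => s; congr (_%:E).
  exact: (variation_integrandE _ _ _ _ _ hB k Y).
rewrite HW ?hDk ?muleA//; last exact: energy_variation_ge0.
by apply: continuous_measurable_fun; exact: continuous_energy_variation.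
Qed.

Theorem mainTheorem2 (R : realType) (p n : nat) (hp : (1 <= p)%N)
  (T eps : R) (hT : 0 < T) (heps : eps = 1 \/ (eps = 0 /\ p = 1%N))
  (B : background R p n) (hB : static_background B)
  (k : 'I_p) (D : 'I_p -> set R)
  (hDk : D k = setT)
  (hD : forall i, measurable (D i) /\ (0 < lebesgue_measure (D i))%E) :
  (forall (Y : 'rV[R]_p -> 'rV[R]_n) (y : R -> 'rV[R]_n),
     static_solution T eps B Y ->
     (forall s, Y s = y (s 0 k)) ->
     [/\ energy T eps B D Y =
           (T%:E * box_integral D
              (fun s => (energy_integrand eps B k y (s 0 k))%:E))%E,
         (energy T eps B D Y \is a fin_num ->
          [/\ (forall lam : R, 0 < lam ->
                 energy T eps B D (rescale k lam Y) \is a fin_num),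
              (T%:E * box_integral D
                 (fun s => (variation_integrand eps B k y (s 0 k))%:E))%E
                \is a fin_num &
              is_derive (1 : R) (1 : R)
                (fun lam => fine (energy T eps B D (rescale k lam Y)))
                (fine (T%:E * box_integral D
                   (fun s => (variation_integrand eps B k y (s 0 k))%:E))%E)]),
         (forall x, (exists a, d_x y a x <> 0) ->
            0 < variation_integrand eps B k y x) &
         (energy T eps B D Y \is a fin_num ->
          (exists x a, d_x y a x <> 0) ->
          derive1 (fun lam => fine (energy T eps B D (rescale k lam Y))) 1
            <> 0)])
  /\
  (forall defs : set (R -> 'rV[R]_p -> 'rV[R]_n),
     (forall Y, configuration B Y -> defs (fun lam => rescale k lam Y)) ->
     ~ exists (Y : 'rV[R]_p -> 'rV[R]_n) (y : R -> 'rV[R]_n),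
         [/\ soliton T eps B D defs Y,
             (forall s, Y s = y (s 0 k)) &
             exists x a, d_x y a x <> 0]).
Proof.
(* Both halves of the theorem are read off from this statement about configurations. *)
have rescaling (Y : 'rV[R]_p -> 'rV[R]_n) (y : R -> 'rV[R]_n) :
  configuration B Y -> (forall s, Y s = y (s 0 k)) ->
  [/\ energy T eps B D Y =
        (T%:E * box_integral D
           (fun s => (energy_integrand eps B k y (s 0 k))%:E))%E,
      (energy T eps B D Y \is a fin_num ->
       [/\ (forall lam : R, 0 < lam ->
              energy T eps B D (rescale k lam Y) \is a fin_num),
           (T%:E * box_integral D
              (fun s => (variation_integrand eps B k y (s 0 k))%:E))%E
             \is a fin_num &
           is_derive (1 : R) (1 : R)
             (fun lam => fine (energy T eps B D (rescale k lam Y)))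
             (fine (T%:E * box_integral D
                (fun s => (variation_integrand eps B k y (s 0 k))%:E))%E)]),
      (forall x, (exists a, d_x y a x <> 0) ->
         0 < variation_integrand eps B k y x) &
      (energy T eps B D Y \is a fin_num ->
       (exists x a, d_x y a x <> 0) ->
       derive1 (fun lam => fine (energy T eps B D (rescale k lam Y))) 1 <> 0)].
  move=> cY Yy.
  have [M M0 [ME MV]] := energy_rescale _ _ _ T eps B k D Y y hT hB hDk hD cY Yy.
  have ch := continuous_rest_density _ _ _ eps B hB k Y y cY Yy.
  have cq := continuous_gradient_sqr _ _ _ B hB k Y y cY Yy.
  have h0 := rest_density_gt0 _ _ _ eps B hB k Y y cY Yy.
  have q0 := gradient_sqr_ge0 _ _ _ B hB k Y y cY Yy.
  have E1 := ME 1 ltr01; rewrite rescale1 in E1.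
  have dE : energy T eps B D Y \is a fin_num ->
      is_derive (1 : R) (1 : R)
        (fun lam => fine (energy T eps B D (rescale k lam Y)))
        (fine (T%:E * box_integral D
           (fun s => (variation_integrand eps B k y (s 0 k))%:E))%E).
    rewrite E1 MV => fE.
    have H := is_derive_rescaled_energy R _ _ ch cq h0 q0 M M0 fE.
    (* The integral formula for the rescaled energy is available for l > 0, hence near 1. *)
    apply: (near_eq_is_derive _ H).
    near=> l; rewrite ME//; near: l; exact: lt_nbhsr.
  split.
  - by apply: (energy_one_coordinate _ _ _ T eps B hB k D _ y) => //; case: cY.
  - move=> fE; split; last exact: dE.
      by move=> l l0; rewrite ME//; rewrite E1 in fE; exact: rescaled_energy_fin_num.
    by rewrite MV; rewrite E1 in fE; exact: energy_variation_fin_num.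
  - move=> x dx; rewrite (variation_integrandE _ _ _ _ _ hB k Y)//.
    by apply: energy_variation_gt0 => //; exact: (gradient_sqr_gt0 _ _ _ _ hB k Y).
  - move=> fE [x [a dx]]; rewrite derive1E (@derive_val _ _ _ _ _ _ _ (dE fE)) MV.
    apply/eqP; rewrite gt_eqF//; rewrite E1 in fE.
    apply: (integral_energy_variation_gt0 _ _ _ _ _ _ _ _ _ _ x) => //.
    by apply: (gradient_sqr_gt0 _ _ _ _ hB k Y) => //; exists a.
split=> [Y y [cY _] Yy|defs hdefs [Y [y [[[cY _] fE minE] Yy ntriv]]]].
  exact: rescaling.
have [_ H2 _ H4] := rescaling Y y cY Yy.
have [fl _ dE] := H2 fE.
(* Rescaling is an admissible deformation, so minimality forces the derivative at 1 to vanish. The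
   inequality of energies passes to [fine] because both are finite for l > 0. *)
apply: (H4 fE ntriv).
have d0 := is_derive_local_min _ _ _ _ dE; rewrite derive1E.
rewrite (@derive_val _ _ _ _ _ _ _ dE) d0// rescale1.
have := minE _ (hdefs Y cY) (rescale1 _ _ _ k Y).
apply: filterS2 (lt_nbhsr ltr01) => l l0 h.
by rewrite fine_le// fl.
Unshelve. all: by end_near. Qed.
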